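(* Let $\mathbb{F}$ be a field of characteristic zero and let $S_2$ be the 4-dimensional $\mathbb{F}$-algebra with basis $e_1,\dots,e_4$ defined in the context. There are no non-trivial left ideals in $S_2$.
   Context: Let $V_2$ be a 2-dimensional vector space over $\mathbb{F}$ with basis $v_1,v_2$. $W(2)$ is the vector space of all bilinear maps $V_2\times V_2\to V_2$ with the (not necessarily associative, not necessarily unital) product $$(A\cdot B)(x,y)=A(v_1,B(x,y))-B(A(v_1,x),y)-B(x,A(v_1,y)),\qquad x,y\in V_2.$$ For $i,j,k\in\{1,2\}$ let $\alpha_{ij}^k\in W(2)$ be given by $\alpha_{ij}^k(v_t,v_l)=\delta_{it}\delta_{jl}v_k$. Put $e_1=\alpha_{11}^1-\alpha_{12}^2-\alpha_{21}^2$, $e_2=\alpha_{11}^2$, $e_3=\alpha_{22}^2-\alpha_{12}^1-\alpha_{21}^1$, $e_4=\alpha_{22}^1$. $S_2$ is the subalgebra of $W(2)$ with basis $e_1,\dots,e_4$ (it consists of the commutative bilinear maps with trace zero multiplication operators). A left ideal of an algebra $W$ is a subspace $I$ with $WI\subseteq I$; it is non-trivial if $I\neq 0$ and $I\neq W$. *)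

(* Defs.v *)
From HB Require Import structures.
From mathcomp Require Import all_boot all_order all_algebra.

Set Implicit Arguments.
Unset Strict Implicit.
Unset Printing Implicit Defensive.

Import GRing.Theory.

Local Open Scope ring_scope.

Section BilinearMaps.

Variables (F : fieldType) (V : vectType F).

(* Bilinear maps V x V -> V in curried form, so that A x y is A(x, y). *)
Definition bilin := 'Hom(V, 'Hom(V, V)).

(* [linfun] is only meaningful on a linear function: [mkbilinE] below. *)
Definition mkbilin (f : V -> V -> V) : bilin :=
  linfun (fun x => linfun (f x)).

Lemma mkbilinE (f : V -> V -> V) :
  (forall x, linear (f x)) -> (forall y, linear (f^~ y)) ->
  forall x y, mkbilin f x y = f x y.
Proof.
move=> fr fl.
have lf x z : linfun (f x) z = f x z.
  pose g : {linear V -> V} :=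
    HB.pack (f x) (GRing.isLinear.Build _ _ _ _ _ (fr x)).
  exact: (lfunE g).
have lin : linear (fun x => linfun (f x) : 'Hom(V, V)).
  move=> a x x'; apply/lfunP => z.
  by rewrite add_lfunE scale_lfunE !lf fl.
pose h : {linear V -> 'Hom(V, V)} :=
  HB.pack (fun x => linfun (f x) : 'Hom(V, V))
    (GRing.isLinear.Build _ _ _ _ _ lin).
move=> x y; rewrite -lf; congr (fun_of_lfun _ y).
exact: (lfunE h).
Qed.

(* The index 0 : 'I_2 stands for 1 and 1 : 'I_2 for 2. *)
Variable v : 2.-tuple V.

Definition wmul (A B : bilin) : bilin :=
  let v1 := tnth v 0 in
  mkbilin (fun x y => A v1 (B x y) - B (A v1 x) y - B x (A v1 y)).

Lemma wmulE (A B : bilin) (x y : V) :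
  wmul A B x y =
  A (tnth v 0) (B x y) - B (A (tnth v 0) x) y - B x (A (tnth v 0) y).
Proof.
have lc (a : F) (p q r s t u : V) :
    a *: p + q - (a *: r + s) - (a *: t + u) = a *: (p - r - t) + (q - s - u).
  rewrite !scalerBr !opprD (addrACA (a *: p)); exact: addrACA.
have lr (f : 'Hom(V, V)) a z z' : f (a *: z + z') = a *: f z + f z'.
  exact: linearP.
have ll (C : bilin) a z z' w : C (a *: z + z') w = a *: C z w + C z' w.
  have -> : C (a *: z + z') = a *: C z + C z' by exact: linearP.
  by rewrite add_lfunE scale_lfunE.
by rewrite mkbilinE // => [z | w] a z1 z2; rewrite /= ?(lr, ll) lc.
Qed.

(* [coord v i] is the i-th coordinate with respect to v, so that
   alpha i j k (v_t, v_l) = delta_it delta_jl v_k: [alphaE] below. *)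
Definition alpha (i j k : 'I_2) : bilin :=
  mkbilin (fun x y => (coord v i x * coord v j y) *: tnth v k).

Lemma alphaE (i j k t l : 'I_2) : basis_of fullv v ->
  alpha i j k (tnth v t) (tnth v l) =
  ((i == t)%:R * (j == l)%:R) *: tnth v k.
Proof.
move=> /basis_free vfree.
have lc (h : 'I_2) a x x' :
    coord v h (a *: x + x') = a * coord v h x + coord v h x'.
  by rewrite linearD linearZ.
rewrite mkbilinE => [|x a y y'|y a x x'] /=.
- by rewrite !(tnth_nth 0) !coord_free // (eq_sym t) (eq_sym l).
- by rewrite lc mulrDr mulrCA scalerDl scalerA.
- by rewrite lc mulrDl -mulrA scalerDl scalerA.
Qed.

Definition e1 : bilin := alpha 0 0 0 - alpha 0 1 1 - alpha 1 0 1.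
Definition e2 : bilin := alpha 0 0 1.
Definition e3 : bilin := alpha 1 1 1 - alpha 0 1 0 - alpha 1 0 0.
Definition e4 : bilin := alpha 1 1 0.

Definition S2 : {vspace bilin} := <<[:: e1; e2; e3; e4]>>%VS.

Definition left_ideal (S I : {vspace bilin}) : Prop :=
  (I <= S)%VS /\
  forall A B : bilin, A \in S -> B \in I -> wmul A B \in I.

Definition nontrivial (S I : {vspace bilin}) : Prop :=
  I <> 0%VS /\ I <> S.

End BilinearMaps.

(* Main.v *)
(* Left multiplication by [A] depends only on the operator [A(v_1, _)], and is
   the natural action of this operator on bilinear maps.  On [S_2] the elements
   [e_1, e_2, e_3] thus act as a basis of [sl_2], and [S_2] is its
   4-dimensional irreducible module: multiplication by [e_3] sends
   [e_2, e_1, e_3, e_4, 0] each to a multiple of the next, and multiplication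
   by [e_2] goes back, with coefficients dividing 6.  So from any nonzero
   element of a left ideal one climbs up to [e_4], and then down to a basis. *)
Require Import Defs.
From HB Require Import structures.
From mathcomp Require Import all_boot all_order all_algebra.

Import GRing.Theory.

Local Open Scope ring_scope.

(** Shaped as an eliminator, so that [elim/ord2P] splits a goal over basis indices. *)
Lemma ord2P (P : 'I_2 -> Prop) : P 0 -> P 1 -> forall i, P i.
Proof.
move=> P0 P1 i; case: (unliftP 0 i) => [j|] -> //.
by rewrite ord1 (_ : lift 0 0 = 1) //; apply: val_inj.
Qed.

Lemma pchar0_natr_neq0 (F : fieldType) (n : nat) :
  [pchar F] =i pred0 -> (0 < n)%N -> n%:R != 0 :> F.
Proof. by move=> /pcharf0P ->; case: n. Qed.

Lemma lfun_basis_ext (F : fieldType) (V W : vectType F) (n : nat)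
  (v : n.-tuple V) (f g : 'Hom(V, W)) :
  basis_of fullv v -> (forall i, f (tnth v i) = g (tnth v i)) -> f = g.
Proof.
move=> vb fg; apply/lfunP => x; rewrite (coord_basis vb (memvf x)) !linear_sum.
by apply: eq_bigr => i _; rewrite !linearZ /= -tnth_nth fg.
Qed.

Lemma bilin_basis_ext (F : fieldType) (V : vectType F) (v : 2.-tuple V)
  (A B : bilin V) : basis_of fullv v ->
  (forall i j, A (tnth v i) (tnth v j) = B (tnth v i) (tnth v j)) -> A = B.
Proof.
move=> vb AB; apply: (lfun_basis_ext _ _ _ _ v _ _ vb) => i.
exact: (lfun_basis_ext _ _ _ _ v _ _ vb).
Qed.

(** Each of the three terms of the product contains the right factor exactly once. *)
Lemma wmul_linear (F : fieldType) (V : vectType F) (v : 2.-tuple V)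
  (A : bilin V) : linear (wmul v A).
Proof.
move=> a B C; apply/lfunP => x; apply/lfunP => y.
rewrite !(add_lfunE, scale_lfunE, wmulE) linearP /= !scalerBr !opprD.
by rewrite (addrACA (a *: A _ _)); exact: addrACA.
Qed.

Section Table.

Variables (F : fieldType) (V : vectType F) (v : 2.-tuple V).
Hypothesis vb : basis_of fullv v.

Let x1 := tnth v 0.
Let x2 := tnth v 1.

(** The four values form a product of equations, hence a single rewrite rule; likewise for the next
    three tables. *)
Lemma e1E : (e1 v x1 x1 = x1) * (e1 v x1 x2 = - x2)
  * (e1 v x2 x1 = - x2) * (e1 v x2 x2 = 0).
Proof.
by do !split; rewrite /e1 !(add_lfunE, opp_lfunE) !alphaE //=
  !(mul0r, mulr0, mul1r, scale0r, scale1r, subr0, sub0r, oppr0).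
Qed.

Lemma e2E : (e2 v x1 x1 = x2) * (e2 v x1 x2 = 0)
  * (e2 v x2 x1 = 0) * (e2 v x2 x2 = 0).
Proof.
by do !split; rewrite /e2 !alphaE //= !(mul0r, mulr0, mul1r, scale0r, scale1r).
Qed.

Lemma e3E : (e3 v x1 x1 = 0) * (e3 v x1 x2 = - x1)
  * (e3 v x2 x1 = - x1) * (e3 v x2 x2 = x2).
Proof.
by do !split; rewrite /e3 !(add_lfunE, opp_lfunE) !alphaE //=
  !(mul0r, mulr0, mul1r, scale0r, scale1r, subr0, sub0r, oppr0).
Qed.

Lemma e4E : (e4 v x1 x1 = 0) * (e4 v x1 x2 = 0)
  * (e4 v x2 x1 = 0) * (e4 v x2 x2 = x1).
Proof.
by do !split; rewrite /e4 !alphaE //= !(mul0r, mulr0, mul1r, scale0r, scale1r).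
Qed.

(** Compares two bilinear maps at the four pairs of basis vectors; the factors 2 and 3 are unrolled
    into repeated sums. *)
Local Ltac table :=
  apply: (bilin_basis_ext _ _ _ _ _ vb); do 2![elim/ord2P];
  rewrite ?wmulE -/x1 -/x2 !(opp_lfunE, scale_lfunE, e1E, e2E, e3E, e4E)
    ?(linearN, linear0, opp_lfunE, zero_lfunE) /=
    ?(e1E, e2E, e3E, e4E, opprK, oppr0, subr0, sub0r, addr0, add0r, scaler0)
    ?scaler_nat ?(mulrS, mulr0n, addr0, opprD, opprK, addrA).

Lemma wmul_e3e2 : wmul v (e3 v) (e2 v) = - e1 v.
Proof. by table. Qed.

Lemma wmul_e3e1 : wmul v (e3 v) (e1 v) = - (2%:R *: e3 v).
Proof. by table. Qed.

Lemma wmul_e3e3 : wmul v (e3 v) (e3 v) = - (3%:R *: e4 v).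
Proof. by table. Qed.

Lemma wmul_e3e4 : wmul v (e3 v) (e4 v) = 0.
Proof. by table. Qed.

Lemma wmul_e2e4 : wmul v (e2 v) (e4 v) = e3 v.
Proof. by table. Qed.

Lemma wmul_e2e3 : wmul v (e2 v) (e3 v) = 2%:R *: e1 v.
Proof. by table. Qed.

Lemma wmul_e2e1 : wmul v (e2 v) (e1 v) = 3%:R *: e2 v.
Proof. by table. Qed.

End Table.

(** The terms are listed in the order in which multiplication by [e3] moves them. *)
Lemma mem_S2 (F : fieldType) (V : vectType F) (v : 2.-tuple V) (B : bilin V) :
  B \in S2 v -> exists a b c d,
    B = b *: e2 v + a *: e1 v + c *: e3 v + d *: e4 v.
Proof.
move=> /(coord_span (X := [tuple e1 v; e2 v; e3 v; e4 v])) ->.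
rewrite !big_ord_recl big_ord0 /= addr0.
by do 4!eexists; rewrite addrCA !addrA.
Qed.

Section LeftIdeal.

Variables (F : fieldType) (V : vectType F) (v : 2.-tuple V).
Hypothesis charF0 : [pchar F] =i pred0.
Hypothesis vb : basis_of fullv v.
Variable I : {vspace bilin V}.
Hypothesis idealI : left_ideal v (S2 v) I.

Let e2_mul_mem (B : bilin V) : B \in I -> wmul v (e2 v) B \in I.
Proof. by apply: idealI.2; rewrite memv_span // !inE eqxx ?orbT. Qed.

Let e3_mul_mem (B : bilin V) : B \in I -> wmul v (e3 v) B \in I.
Proof. by apply: idealI.2; rewrite memv_span // !inE eqxx ?orbT. Qed.

Let memZ (a : F) (B : bilin V) : a != 0 -> a *: B \in I -> B \in I.
Proof. by move=> a0; rewrite rpredZeq (negPf a0). Qed.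

Let wmul_comb (A B C D E : bilin V) (a b c d : F) :
  wmul v A (b *: B + a *: C + c *: D + d *: E) =
  b *: wmul v A B + a *: wmul v A C + c *: wmul v A D + d *: wmul v A E.
Proof.
pose f : {linear bilin V -> bilin V} :=
  HB.pack (wmul v A) (GRing.isLinear.Build _ _ _ _ _ (wmul_linear _ _ v A)).
by rewrite -[wmul v A]/(f : _ -> _) !linearD !linearZ.
Qed.

Lemma left_ideal_e4 : I <> 0%VS -> e4 v \in I.
Proof.
have n2 := pchar0_natr_neq0 F 2 charF0 isT.
have n3 := pchar0_natr_neq0 F 3 charF0 isT.
(* Multiplication by [e3] in coordinates; the zero term stays explicit so that the step can be
   iterated. *)
have climb a b c d : b *: e2 v + a *: e1 v + c *: e3 v + d *: e4 v \in I ->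
    0 *: e2 v + (- b) *: e1 v + (- (2%:R * a)) *: e3 v + (- (3%:R * c)) *: e4 v
      \in I.
  move/e3_mul_mem; rewrite wmul_comb wmul_e3e2 // wmul_e3e1 // wmul_e3e3 //.
  rewrite wmul_e3e4 // !scalerN !scaleNr !scalerA !(mulrC _ _%:R).
  by rewrite scale0r scaler0 add0r addr0.
have top d : d != 0 ->
    0 *: e2 v + 0 *: e1 v + 0 *: e3 v + d *: e4 v \in I -> e4 v \in I.
  by move=> d0; rewrite !scale0r !add0r; apply: memZ.
have climb0 := (oppr0, mulr0).
move=> /eqP; rewrite -vpick0; move: (memv_pick I).
have [a [b [c [d ->]]]] := mem_S2 _ _ _ _ (subvP idealI.1 _ (memv_pick I)).
(* The first nonzero coefficient decides how often to climb. If it is [b], three climbs leave only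
   -6b times [e4]; two turn [a] into 6a, and one turns [c] into -3c. *)
have [->|b0] := eqVneq b 0; last first.
  do 3!move/climb; rewrite !climb0 => BI _; apply: top BI.
  by rewrite !(mulrN, opprK, oppr_eq0, mulf_neq0).
have [->|a0] := eqVneq a 0; last first.
  do 2!move/climb; rewrite !climb0 => BI _; apply: top BI.
  by rewrite !(mulrN, opprK, oppr_eq0, mulf_neq0).
have [->|c0] := eqVneq c 0; last first.
  move/climb; rewrite !climb0 => BI _; apply: top BI.
  by rewrite oppr_eq0 mulf_neq0.
have [->|d0] := eqVneq d 0; last by move=> BI _; apply: top BI.
(* All coefficients vanish, although the picked vector is nonzero. *)
by rewrite !scale0r !addr0 eqxx.
Qed.

Lemma left_ideal_full : e4 v \in I -> I = S2 v.
Proof.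
move=> I4.
have I3 : e3 v \in I by rewrite -wmul_e2e4 // e2_mul_mem.
have I1 : e1 v \in I.
  (* The descent only yields 2 times [e1], and below 3 times [e2]; characteristic zero allows the
     division. *)
  apply: memZ (pchar0_natr_neq0 F 2 charF0 isT) _.
  by rewrite -wmul_e2e3 // e2_mul_mem.
have I2 : e2 v \in I.
  apply: memZ (pchar0_natr_neq0 F 3 charF0 isT) _.
  by rewrite -wmul_e2e1 // e2_mul_mem.
apply: subv_anti; rewrite idealI.1; apply/span_subvP => B.
by rewrite !inE => /or4P[] /eqP ->.
Qed.

End LeftIdeal.

Theorem lemma6 (F : fieldType) (charF0 : [pchar F] =i pred0)
  (V : vectType F) (dimV : \dim {:V} = 2%N)
  (v : 2.-tuple V) (v_basis : basis_of fullv v) :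
  ~ exists I : {vspace bilin V}, left_ideal v (S2 v) I /\ nontrivial (S2 v) I.
Proof.
move=> [I [idealI [I_neq0 I_neqS2]]].
apply: I_neqS2; apply: left_ideal_full => //.
exact: left_ideal_e4.
Qed.
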